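(* Let $\mathcal M$ be a Hilbert-Burch matrix of standard form, of size $(r+1)\times r$, and let $U_{\mathcal M}\subseteq C_{2,2r}$ be the associated set of pairs. Then $U_{\mathcal M}$ is a generalized towerizable set.
   Context: Notation. $\mathbb Z_+$ is the set of positive integers, $[r]=\{1,\ldots,r\}$, $C_{2,N}$ is the set of $2$-element subsets of $[N]$, $(\mathbb Z_+^2)^*=\{(a,b)\in\mathbb Z_+^2\mid a\ne b\}$, $\pi_1,\pi_2$ are the coordinate projections. Standard form. A Hilbert-Burch matrix $\mathcal M$ of standard form is an $(r+1)\times r$ matrix (rows numbered $0,\ldots,r$, columns numbered $1,\ldots,r$) over $k[x_1,\ldots,x_n]$, which is a Hilbert-Burch matrix of an aCM monomial ideal of height $2$ (the maximal minors minimally generate the ideal), such that column $j$ has exactly two nonzero entries, both monomials: $D_j$ in position $(j,j)$ and $M_j$ in position $(\sigma(j),j)$, where $\sigma:[r]\to\{0,\ldots,r-1\}$ satisfies $\sigma(j)<j$, $\sigma(1)=0$, $\sigma(2)=1$, and $\sigma(j)\ge\sigma(j-1)>0$ for $j>2$. For $j\in[r]$ let $m(j):=\{j,\sigma(j),\sigma^2(j),\ldots,\sigma^h(j)\}$, where $h$ is the unique integer with $\sigma^h(j)=1$. Define $$U'_{\mathcal M}:=\{\{i,j\}\in C_{2,2r}\mid i<j\le r,\ i\notin m(j)\},\qquad U''_{\mathcal M}:=\{\{i,j\}\in C_{2,2r}\mid i\le r<j,\ j-r\in m(i)\},$$ and $U_{\mathcal M}:=U'_{\mathcal M}\cup U''_{\mathcal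 M}$. Generalized tower sets. For finite $T\subset\mathbb Z_+^2$ and $j\in\mathbb Z_+$ put $T_j=\{i\mid(i,j)\in T\}$; $T$ is a tower set if $T_a\supseteq T_b$ whenever $a<b$ and $T_a\ne\emptyset$. For a tower set $T\subset(\mathbb Z_+^2)^*$ and $h\in\pi_1(T)\cap\pi_2(T)$ put $F_T(h):=\{j\in\pi_2(T)\mid T_h\subsetneq T_j\text{ and }(h,j)\notin T\}$. A set $U$ of $2$-element sets is connected if for all $A,B\in U$ there is $C\in U$ meeting both $A$ and $B$; $S\subset(\mathbb Z_+^2)^*$ is connected if $\{\{a,b\}\mid(a,b)\in S\}$ is. A finite set $S\subset(\mathbb Z_+^2)^*$ is a generalized tower set if: (1) $S$ is connected; (2) $S=T\cup S_0$ with $T$ a tower set; (3) for every $(i,j)\in S_0$, $i\notin\pi_1(T)\cup\pi_2(T)$ and $j\in\pi_1(T)\cap\pi_2(T)$; (4) for every $(i,j)\in S_0$ and $h\in F_T(j)$, $(i,h)\in S_0$. Generalized towerizable. An ordinante function is a map $\omega:C_{2,N}\to(\mathbb Z_+^2)^*$ sending each $\{a,b\}$ to $(a,b)$ or $(b,a)$. A set $U\subseteq C_{2,N}$ is generalized towerizable if there exist an ordinante function $\omega$ and a permutation $\tau$ of $\pi_2(\omega(U))$ (extended by the identity, and applied to both coordinates) such that $\tau(\omega(U))$ is a generalized tower set. *)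

(* Defs.v *)
From HB Require Import structures.
From mathcomp Require Import all_boot all_order all_fingroup all_algebra.
From mathcomp Require Import finmap mpoly.

Set Implicit Arguments.
Unset Strict Implicit.
Unset Printing Implicit Defensive.

Import GRing.Theory.

(* [idealr_closed] includes [1 \notin I], so the ideals below are proper. *)

Section CommutativeAlgebra.
Local Open Scope ring_scope.
Variable R : comNzRingType.
Implicit Types (I P Q : {pred R}) (s : seq R).

Definition prime_ideal P : Prop := idealr_closed P /\ prime_idealr_closed P.

Definition maximal_ideal P : Prop :=
  idealr_closed P /\
  forall Q, idealr_closed Q -> {subset P <= Q} -> {subset Q <= P}.

(* P_0, ..., P_d is a strictly increasing chain of primes (length d). *)
Definition prime_chain (d : nat) (Pc : nat -> {pred R}) : Prop :=
  (forall i, (i <= d)%N -> prime_ideal (Pc i)) /\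
  (forall i, (i < d)%N ->
     {subset Pc i <= Pc i.+1} /\
     exists2 x, x \in Pc i.+1 & x \notin Pc i).

(* height P >= d, for a prime P *)
Definition prime_height_ge P (d : nat) : Prop :=
  exists Pc, prime_chain d Pc /\ Pc d =i P.

(* height I = d: the infimum of the heights of the primes containing I is
   reached and equal to d. *)
Definition ideal_height I (d : nat) : Prop :=
  (forall P, prime_ideal P -> {subset I <= P} -> prime_height_ge P d) /\
  (exists P, [/\ prime_ideal P, {subset I <= P} & ~ prime_height_ge P d.+1]).

(* height (P / I) >= d in the ring R / I *)
Definition quotient_height_ge I P (d : nat) : Prop :=
  exists Pc, [/\ prime_chain d Pc, {subset I <= Pc 0%N} & Pc d =i P].

(* x belongs to I + (s) *)
Definition in_ideal_plus I s (x : R) : Prop :=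
  exists c : nat -> R, x - \sum_(i < size s) c i * s`_i \in I.

(* s is a regular sequence on R / I contained in the prime P (the condition
   I + (s) <> R is then automatic for I included in P). *)
Definition regular_sequence_in I P s : Prop :=
  {subset s <= P} /\
  forall i, (i < size s)%N -> forall x,
    in_ideal_plus I (take i s) (s`_i * x) -> in_ideal_plus I (take i s) x.

(* R / I is Cohen-Macaulay: depth and height agree at every maximal ideal of
   R / I.  Both sides of the equivalence are downward closed in d. *)
Definition cohen_macaulay_quotient I : Prop :=
  forall P, maximal_ideal P -> {subset I <= P} ->
  forall d, quotient_height_ge I P d <->
    exists s, size s = d /\ regular_sequence_in I P s.

Definition generated_by (T : finType) I (f : T -> R) : Prop :=
  forall x, x \in I <-> exists c : T -> R, x = \sum_t c t * f t.

Definition minimally_generated_by (T : finType) I (f : T -> R) : Prop :=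
  generated_by I f /\
  forall t, ~ exists c : T -> R, f t = \sum_(u | u != t) c u * f u.

Definition signed_minors (r : nat) (M : 'M[R]_(r.+1, r)) : 'rV[R]_r.+1 :=
  \row_i ((-1) ^+ i * \det (row' i M)).

(* The maximal minors of M minimally generate I, and
     0 --> R^r --M--> R^(r+1) --minors--> I --> 0
   is exact: the uniqueness of u is the injectivity of M.  The signs of the
   minors are those for which the composite is zero. *)
Definition hilbert_burch (r : nat) (M : 'M[R]_(r.+1, r)) I : Prop :=
  minimally_generated_by I (fun i => signed_minors M 0 i) /\
  forall v : 'cV[R]_r.+1,
    signed_minors M *m v = 0 <-> exists! u : 'cV[R]_r, v = M *m u.

End CommutativeAlgebra.

Section StandardForm.
Local Open Scope ring_scope.
Variables (k : fieldType) (n : nat).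

Definition is_monomial (p : {mpoly k[n]}) : Prop := exists m, p = 'X_[m].

Definition monomial_ideal (I : {pred {mpoly k[n]}}) : Prop :=
  exists s : seq 'X_{1..n},
    generated_by I (fun i : 'I_(size s) => 'X_[tnth (in_tuple s) i]).

(* Only the values of sigma on [1, r] matter. *)
Definition standard_sigma (r : nat) (sigma : nat -> nat) : Prop :=
  [/\ forall j, (0 < j <= r)%N -> (sigma j < j)%N,
      (1 <= r)%N -> sigma 1%N = 0%N,
      (2 <= r)%N -> sigma 2%N = 1%N
    & forall j, (2 < j <= r)%N -> (0 < sigma j.-1 <= sigma j)%N].

(* Rows are numbered 0, ..., r as in 'I_r.+1; the column numbered j (with
   1 <= j <= r) is the one of index j.-1 in 'I_r. *)
Definition standard_form (r : nat) (M : 'M[{mpoly k[n]}]_(r.+1, r))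
    (sigma : nat -> nat) : Prop :=
  [/\ exists I : {pred {mpoly k[n]}},
        [/\ idealr_closed I, monomial_ideal I, ideal_height I 2,
            cohen_macaulay_quotient I & hilbert_burch M I],
      standard_sigma r sigma
    & forall (i : 'I_r.+1) (j : 'I_r),
        if (i == j.+1 :> nat) || (i == sigma j.+1 :> nat)
        then is_monomial (M i j) else M i j = 0].

End StandardForm.

Local Open Scope fset_scope.

(* C_{2,N}; the integer interval [1, N] is [iota 1 N]. *)
Definition C2 (N : nat) : {fset {fset nat}} :=
  [fset [fset a; b] | a in iota 1 N, b in iota 1 N & a != b].

Section AssociatedSet.
Variables (r : nat) (sigma : nat -> nat).

(* The h such that sigma^h(j) = 1: as sigma decreases, it is less than j, and
   it is taken to be the first one since sigma may be continued past 0. *)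
Definition m_exponent (j : nat) : nat := index 1 (traject sigma j j).

Definition m_chain (j : nat) : {fset nat} :=
  [fset iter t sigma j | t in iota 0 (m_exponent j).+1].

Definition U' : {fset {fset nat}} :=
  [fset [fset i; j] | i in iota 1 (2 * r), j in iota 1 (2 * r)
     & [&& i < j, j <= r & i \notin m_chain j]].

Definition U'' : {fset {fset nat}} :=
  [fset [fset i; j] | i in iota 1 (2 * r), j in iota 1 (2 * r)
     & [&& i <= r, r < j & j - r \in m_chain i]].

Definition U_ : {fset {fset nat}} := U' `|` U''.

End AssociatedSet.

Section TowerSets.
Implicit Types S T : {fset nat * nat}.

Definition offdiagonal S : Prop :=
  forall p, p \in S -> [/\ 0 < p.1, 0 < p.2 & p.1 != p.2].

Definition pi1 S : {fset nat} := [fset p.1 | p in S].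
Definition pi2 S : {fset nat} := [fset p.2 | p in S].

Definition slice T (j : nat) : {fset nat} := [fset p.1 | p in T & p.2 == j].

Definition tower_set T : Prop :=
  forall a b, a < b -> slice T a != fset0 -> slice T b `<=` slice T a.

Definition F_ T (h : nat) : {fset nat} :=
  [fset j in pi2 T | (slice T h `<` slice T j) && ((h, j) \notin T)].

Definition connected (U : {fset {fset nat}}) : Prop :=
  forall A B, A \in U -> B \in U ->
  exists C, [/\ C \in U, A `&` C != fset0 & B `&` C != fset0].

Definition generalized_tower_set S : Prop :=
  offdiagonal S /\
  connected [fset [fset p.1; p.2] | p in S] /\
  exists T S0,
    [/\ S = T `|` S0, tower_set T,
        forall i j, (i, j) \in S0 ->
          i \notin pi1 T `|` pi2 T /\ j \in pi1 T `&` pi2 T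
      & forall i j h, (i, j) \in S0 -> h \in F_ T j -> (i, h) \in S0].

Definition ordinante (N : nat) (omega : {fset nat} -> nat * nat) : Prop :=
  forall a b, a \in iota 1 N -> b \in iota 1 N -> a != b ->
    omega [fset a; b] = (a, b) \/ omega [fset a; b] = (b, a).

(* A permutation of P extended by the identity. *)
Definition extend_perm (P : {fset nat}) (tau : {perm P}) (x : nat) : nat :=
  if insub x is Some u then val (tau u) else x.

Definition generalized_towerizable (N : nat) (U : {fset {fset nat}}) : Prop :=
  U `<=` C2 N /\
  exists omega, ordinante N omega /\
  let S := [fset omega A | A in U] in
  exists tau : {perm (pi2 S)},
    generalized_tower_set
      [fset (extend_perm tau p.1, extend_perm tau p.2) | p in S].

End TowerSets.

(* Main.v *)
Require Import Defs.
From mathcomp Require Import all_boot all_fingroup all_algebra finmap mpoly.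

(* The map sigma makes [1, r] a tree rooted at 1, in which m(j) is the set of
   ancestors of j.  Besides the pairs {s + r, j} with s an ancestor of j, U_M
   consists of the pairs of incomparable nodes; these are oriented as (i, j)
   with i to the left of j in a planar drawing of the tree.  Then the set of
   nodes to the left of j grows with j along the depth-first order.  The same
   holds after adding to it the s + r for the ancestors s of j on the rightmost
   branch, so these pairs form T, and its slices form a chain.  The pairs
   (s + r, j) with s off the rightmost branch form S_0.  Such a j has
   nodes to its right, hence is also a row of T, and F_T(j) consists of
   descendants of j, which have s as an ancestor as well.  Finally tau sorts the columns by
   decreasing size of their slices. *)

Set Implicit Arguments.
Unset Strict Implicit.
Unset Printing Implicit Defensive.
Local Open Scope fset_scope.
Local Open Scope nat_scope.

(** * Relabelling and orientation of pairs *)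

(** List [P] by increasing label in [s1] and by decreasing [f] in [s2]; [tau] sends each entry of
    [s2] to the entry of [s1] of the same rank. *)
Lemma perm_sorting (P : {fset nat}) (f : nat -> nat) :
  exists tau : {perm P}, forall u v, val (tau u) < val (tau v) -> f (val v) <= f (val u).
Proof.
pose leP := fun u v : P => val u <= val v.
pose leF := fun u v : P => f (val v) <= f (val u).
have leP_total : total leP by move=> u v; apply: leq_total.
have leP_trans : transitive leP by move=> u v w; apply: leq_trans.
have leF_total : total leF by move=> u v; apply: leq_total.
have leF_trans : transitive leF by move=> u v w h1 h2; apply: leq_trans h2 h1.
pose s1 := sort leP (enum {: P}); pose s2 := sort leF (enum {: P}).
have us1 : uniq s1 by rewrite sort_uniq enum_uniq.
have idx u : index u s2 < size s1.
  rewrite size_sort -[X in _ < X](size_sort leF) index_mem mem_sort.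
  by rewrite mem_enum.
(* The default of [nth] is the argument itself, so it varies with the argument; [idx] allows one
   default to be exchanged for another. *)
have tau_inj : injective (fun u => nth u s1 (index u s2)).
  move=> u v; rewrite (set_nth_default u v (idx v)) => /eqP.
  rewrite nth_uniq // => /eqP/(congr1 (nth u s2)).
  by rewrite !nth_index // mem_sort mem_enum.
exists (perm tau_inj) => u v; rewrite !permE => lt_uv.
have [|le_vu] := leqP (index u s2) (index v s2).
  move=> le_uv; have := sorted_leq_nth leF_trans (fun u => leqnn _) u (sort_sorted leF_total _).
  move/(_ (enum {: P}) (index u s2) (index v s2)).
  rewrite !inE -/s2 !index_mem !nth_index ?mem_sort ?mem_enum //.
  by apply.
(* Here [v] strictly precedes [u] in [s2], so sortedness of [s1] contradicts [lt_uv]. *)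
have := sorted_leq_nth leP_trans (fun u => leqnn _) u (sort_sorted leP_total _).
move/(_ (enum {: P}) (index v s2) (index u s2)); rewrite !inE -/s1 !idx => /(_ isT isT (ltnW le_vu)).
by rewrite (set_nth_default v u (idx v)) /leP leqNgt lt_uv.
Qed.

Lemma extend_permK (P : {fset nat}) (tau : {perm P}) :
  cancel (extend_perm tau) (extend_perm tau^-1).
Proof.
move=> x; rewrite /extend_perm; case: (insubP _ x) => [u xP <-|xP]; last by rewrite insubN.
by rewrite valK permK.
Qed.

Lemma extend_permVK (P : {fset nat}) (tau : {perm P}) :
  cancel (extend_perm tau^-1) (extend_perm tau).
Proof. by move=> x; rewrite -{1}[tau]invgK extend_permK. Qed.

Lemma extend_perm_mem (P : {fset nat}) (tau : {perm P}) x :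
  (extend_perm tau x \in P) = (x \in P).
Proof.
by rewrite /extend_perm; case: insubP => [u -> _|/negPf ->]; rewrite ?(valP (tau u)).
Qed.

Lemma pi1P (S : {fset nat * nat}) i : reflect (exists j, (i, j) \in S) (i \in pi1 S).
Proof.
apply: (iffP (imfsetP _ _ _ _)) => [[[a b] /= abS ->]|[j ijS]]; first by exists b.
by exists (i, j).
Qed.

Lemma pi2P (S : {fset nat * nat}) j : reflect (exists i, (i, j) \in S) (j \in pi2 S).
Proof.
apply: (iffP (imfsetP _ _ _ _)) => [[[a b] /= abS ->]|[i ijS]]; first by exists a.
by exists (i, j).
Qed.

Lemma mem_slice (S : {fset nat * nat}) i j : (i \in slice S j) = ((i, j) \in S).
Proof.
apply/imfsetP/idP => [[[a b] /=]|ijS].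
  by rewrite !inE /= => /andP[abS /eqP <-] ->.
by exists (i, j); rewrite //= !inE ijS eqxx.
Qed.

Section Relabel.
Variables (T S0 : {fset nat * nat}).
Let S := T `|` S0.
Hypothesis offS : offdiagonal S.
Hypothesis connS : connected [fset [fset p.1; p.2] | p in S].
Hypothesis chainT : forall a b, slice T a `<=` slice T b \/ slice T b `<=` slice T a.
Hypothesis S0_out : forall i j, (i, j) \in S0 ->
  i \notin pi1 T `|` pi2 T /\ j \in pi1 T `&` pi2 T.
Hypothesis S0_closed : forall i j h, (i, j) \in S0 -> h \in F_ T j -> (i, h) \in S0.

(** Connectedness and the conditions on [S0] survive any bijective relabelling; the tower condition
    depends on the order of the labels. For it, [tau] puts the columns with larger slices first: in
    a chain of sets, the one of larger cardinality contains the other. *)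
Lemma generalized_tower_relabel : exists tau : {perm (pi2 S)},
  generalized_tower_set [fset (extend_perm tau p.1, extend_perm tau p.2) | p in S].
Proof.
have [tau tauP] := perm_sorting (pi2 S) (fun j => #|` slice T j|).
exists tau; set phi := extend_perm tau; set psi := extend_perm tau^-1.
have phiK : cancel phi psi := extend_permK tau.
have psiK : cancel psi phi := extend_permVK tau.
pose img (X : {fset nat * nat}) := [fset (phi p.1, phi p.2) | p in X].
have imgE (X : {fset nat * nat}) i j : ((i, j) \in img X) = ((psi i, psi j) \in X).
  apply/imfsetP/idP => [[[a b] /= abX [-> ->]]|ijX]; first by rewrite !phiK.
  by exists (psi i, psi j); rewrite //= !psiK.
have sliceE (X : {fset nat * nat}) i j : (i \in slice (img X) j) = (psi i \in slice X (psi j)).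
  by rewrite !mem_slice imgE.
have pi1E (X : {fset nat * nat}) i : (i \in pi1 (img X)) = (psi i \in pi1 X).
  apply/pi1P/pi1P => [[j]|[j ijX]]; first by rewrite imgE; exists (psi j).
  by exists (phi j); rewrite imgE phiK.
have pi2E (X : {fset nat * nat}) j : (j \in pi2 (img X)) = (psi j \in pi2 X).
  apply/pi2P/pi2P => [[i]|[i ijX]]; first by rewrite imgE; exists (psi i).
  by exists (phi i); rewrite imgE phiK.
have subE (X : {fset nat * nat}) a b :
    (slice (img X) a `<=` slice (img X) b) = (slice X (psi a) `<=` slice X (psi b)).
  apply/fsubsetP/fsubsetP => sab i.
    by have := sab (phi i); rewrite !sliceE phiK.
  by rewrite !sliceE; apply: sab.
(* A column label goes to another column label, which is positive by [offS]; any other label is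
   fixed. *)
have phi_gt0 x : 0 < x -> 0 < phi x.
  move=> x0; have [xS|xS] := boolP (x \in pi2 S).
    have : phi x \in pi2 S by rewrite extend_perm_mem.
    by case/pi2P=> i /offS[].
  by rewrite /phi /extend_perm insubN.
split; last split.
- move=> [a b] /=; rewrite imgE => /offS[/= a0 b0 ab].
  have := phi_gt0 _ a0; have := phi_gt0 _ b0; rewrite !psiK => -> ->; split=> //.
  by apply: contraNneq ab => ->.
- have imgA A : A \in [fset [fset p.1; p.2] | p in img S] ->
      exists2 B, B \in [fset [fset p.1; p.2] | p in S] & A = [fset phi x | x in B].
    case/imfsetP=> [[a b] /=]; rewrite imgE => abS ->.
    exists [fset psi a; psi b]; first by apply/imfsetP; exists (psi a, psi b).
    apply/fsetP => x; rewrite -{2}[x]psiK (mem_imfset _ _ (can_inj phiK)) !inE.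
    by rewrite !(can_eq psiK).
  move=> A1 A2 /imgA[B1 B1S ->] /imgA[B2 B2S ->].
  have [C [/imfsetP[[a b] /= abS ->] meet1 meet2]] := connS B1S B2S.
  exists [fset phi a; phi b]; split.
  + by apply/imfsetP; exists (phi a, phi b); rewrite //= imgE !phiK.
  + have /fset0Pn[x /fsetIP[xB xC]] := meet1; apply/fset0Pn; exists (phi x).
    rewrite inE (in_imfset _ phi xB) /=.
    by move: xC; rewrite !inE => /orP[]/eqP->; rewrite eqxx ?orbT.
  + have /fset0Pn[x /fsetIP[xB xC]] := meet2; apply/fset0Pn; exists (phi x).
    rewrite inE (in_imfset _ phi xB) /=.
    by move: xC; rewrite !inE => /orP[]/eqP->; rewrite eqxx ?orbT.
exists (img T), (img S0); split.
- by apply/fsetP=> -[a b]; rewrite imgE inE !imgE inE.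
- move=> a b lt_ab /fset0Pn[x]; rewrite sliceE mem_slice => xa.
  rewrite subE; apply/fsubsetP => y yb.
  have aS : psi a \in pi2 S by apply/pi2P; exists (psi x); rewrite inE xa.
  have bS : psi b \in pi2 S.
    by apply/pi2P; exists y; rewrite inE -mem_slice yb.
  (* [tauP] speaks only of elements of [pi2 S]; both columns are there because their slices are
     nonempty. *)
  have := tauP [` aS] [` bS].
  have ext c (cS : psi c \in pi2 S) : val (tau [` cS]) = c.
    by rewrite -[RHS]psiK /phi /extend_perm (insubT (fun z => z \in pi2 S) cS).
  rewrite !ext => /(_ lt_ab) /= le_ba.
  (* If the chain gives the opposite inclusion, [le_ba] turns it into an equality. *)
  have [/fsubsetP|sub_ab] := chainT (psi b) (psi a); first exact.
  by move: yb; have /eqP-> : slice T (psi a) == slice T (psi b) by rewrite eqEfcard sub_ab.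
- move=> i j; rewrite imgE => /S0_out.
  by rewrite !inE !pi1E !pi2E.
- move=> i j h; rewrite !imgE => ijS0 hF; apply: S0_closed ijS0 _.
  by move: hF; rewrite !inE /= !pi2E !fproperE !subE imgE.
Qed.

End Relabel.

(** By asymmetry at most one orientation of a pair lies in [S], so testing a single orientation
    decides which one to choose. *)
Lemma ordinante_orientation N (S : {fset nat * nat}) :
    (forall i j, (i, j) \in S -> i != j /\ (j, i) \notin S) ->
  exists omega, ordinante N omega /\
    [fset omega A | A in [fset [fset p.1; p.2] | p in S]] = S.
Proof.
move=> asymS.
(* The two elements of a pair are recovered as its maximum and as its sum minus its maximum. *)
pose hi (A : {fset nat}) := \max_(x <- A) x.
pose lo (A : {fset nat}) := \sum_(x <- A) x - hi A.
pose omega A := if (lo A, hi A) \in S then (lo A, hi A) else (hi A, lo A).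
have omega_lt a b : a < b ->
    omega [fset a; b] = if (a, b) \in S then (a, b) else (b, a).
  move=> ab; have ne : a \notin [fset b] by rewrite inE ltn_eqF.
  have hiE : hi [fset a; b] = b.
    by rewrite /hi big_fsetU1 //= big_seq_fset1; apply/maxn_idPr/ltnW.
  have loE : lo [fset a; b] = a.
    by rewrite /lo hiE big_fsetU1 //= big_seq_fset1 addnK.
  by rewrite /omega hiE loE.
exists omega; split.
  move=> a b _ _ ab; case: (ltngtP a b) => [lt_ab|lt_ba|eq_ab].
  - by rewrite omega_lt //; case: ifP; [left|right].
  - by rewrite fsetUC omega_lt //; case: ifP; [right|left].
  - by rewrite eq_ab eqxx in ab.
have omegaS p : p \in S -> omega [fset p.1; p.2] = p.
  case: p => a b abS /=; have [ab baS] := asymS _ _ abS.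
  case: (ltngtP a b) => [lt_ab|lt_ba|eq_ab]; first by rewrite omega_lt // abS.
  - by rewrite fsetUC omega_lt // (negPf baS).
  - by rewrite eq_ab eqxx in ab.
apply/fsetP=> p; apply/imfsetP/idP => /= [[_ /imfsetP[q /= qS ->] ->]|pS].
  by rewrite omegaS.
by exists [fset p.1; p.2]; rewrite ?omegaS //; apply/imfsetP; exists p.
Qed.

Lemma mem_iota1 n i : (i \in iota 1 n) = (0 < i <= n).
Proof. by rewrite mem_iota add1n ltnS. Qed.

Lemma imfset_pairsP n (P : nat -> nat -> bool) (A : {fset nat}) : reflect
  (exists i j, [/\ 0 < i <= n, 0 < j <= n, P i j & A = [fset i; j]])
  (A \in [fset [fset i; j] | i in iota 1 n, j in iota 1 n & P i j]).
Proof.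
apply: (iffP (imfset2P _ _ _ _ _)) => [[i hi [j hj ->]]|[i [j [hi hj Pij ->]]]].
  exists i, j; have /andP[hj' Pij] : (j \in iota 1 n) && P i j by move: hj; rewrite !inE.
  by rewrite -!mem_iota1.
rewrite -!mem_iota1 in hi hj; exists i => //; exists j => //.
by rewrite !inE; apply/andP.
Qed.

(** * The tree of sigma *)

Section Tree.
Variables (r : nat) (sigma : nat -> nat).
Hypothesis parentP : forall j, 1 < j <= r -> 0 < sigma j < j.

Lemma mem1_traject j n : 0 < j <= r -> j <= n -> 1 \in traject sigma j n.
Proof.
elim: n j => [|n IH] j /andP[j0 jr]; first by rewrite leqn0 => /eqP j0'; rewrite j0' in j0.
move=> jn; rewrite /= inE; case: (ltngtP 1 j) => [j1|j1|//] /=.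
  have /andP[s0 sj] := parentP (introT andP (conj j1 jr)).
  apply: IH; first by rewrite s0 (leq_trans (ltnW sj) jr).
  by rewrite -ltnS (leq_trans sj jn).
by rewrite ltnS leqNgt j0 in j1.
Qed.

(** The value 1 already occurs among the first [j] terms, so lengthening the trajectory does not
    move its first occurrence. This reconciles the different truncations used for [j] and for
    [sigma j]. *)
Lemma m_exponentE j n :
  0 < j <= r -> j <= n -> index 1 (traject sigma j n) = m_exponent sigma j.
Proof.
move=> hj jn; rewrite -(subnKC jn) trajectD index_cat.
by rewrite (mem1_traject hj (leqnn j)).
Qed.

Lemma m_exponentS j : 1 < j <= r -> m_exponent sigma j = (m_exponent sigma (sigma j)).+1.
Proof.
move=> hj; have /andP[s0 sj] := parentP hj; case/andP: (hj) => j1 jr.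
(* The length [j.-1] is that of the tail of [traject sigma j j], which starts at [sigma j]. *)
rewrite -(@m_exponentE (sigma j) j.-1); last 2 first.
- by rewrite s0 (leq_trans (ltnW sj)).
- by rewrite -ltnS (ltn_predK j1).
rewrite /m_exponent -{2}(ltn_predK j1) /=.
by case: eqP j1 => // ->.
Qed.

Lemma m_chainP x j : reflect
  (exists2 t, t <= m_exponent sigma j & x = iter t sigma j) (x \in m_chain sigma j).
Proof.
have E t : (t \in iota 0 (m_exponent sigma j).+1) = (t <= m_exponent sigma j).
  by rewrite mem_iota.
apply: (iffP (imfsetP _ _ _ _)) => -[t ht ->]; exists t => //.
  by rewrite -E.
by move: ht; rewrite -E.
Qed.

(** This recursion through the parent replaces the iterates of [sigma] in all that follows. *)
Lemma mem_m_chain x j :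
  0 < j <= r ->
  (x \in m_chain sigma j) = (x == j) || ((1 < j) && (x \in m_chain sigma (sigma j))).
Proof.
move=> hj; have [->|j1] := eqVneq j 1.
  by rewrite orbF; apply/m_chainP/eqP => [[[|t]] //= | ->]; exists 0.
have {hj}hj : 1 < j <= r.
  by case/andP: hj => j0 ->; rewrite ltn_neqAle eq_sym j1 j0.
have -> /= : 1 < j by case/andP: hj.
apply/m_chainP/orP; rewrite m_exponentS //.
  case=> [[|t] ht ->]; first by left.
  by right; apply/m_chainP; exists t; rewrite -?iterSr.
case=> [/eqP->|/m_chainP[t ht ->]]; first by exists 0.
by exists t.+1; rewrite // -iterSr.
Qed.

Lemma anc_refl y : 0 < y <= r -> y \in m_chain sigma y.
Proof. by move=> hy; rewrite mem_m_chain // eqxx. Qed.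

Lemma parent_range y : 1 < y <= r -> 0 < sigma y <= r.
Proof.
move=> hy; have /andP[-> /ltnW sy] := parentP hy.
by case/andP: hy => _; apply: leq_trans.
Qed.

Lemma anc_ind (P : nat -> Prop) :
    P 1 -> (forall y, 1 < y <= r -> P (sigma y) -> P y) ->
  forall y, 0 < y <= r -> P y.
Proof.
move=> P1 Ps; elim/ltn_ind => y IH hy; case: (ltngtP y 1) => [|y1|-> //].
  by case/andP: hy; case: (y).
have hy' : 1 < y <= r by case/andP: hy => _ ->; rewrite y1.
by apply: Ps => //; apply: IH; [case/andP: (parentP hy')|apply: parent_range].
Qed.


Lemma anc_parent y : 1 < y <= r -> sigma y \in m_chain sigma y.
Proof.
move=> hy; rewrite mem_m_chain; last by case/andP: hy => /ltnW ->.
by case/andP: (hy) => -> _; rewrite anc_refl ?orbT //; apply: parent_range.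
Qed.

Lemma anc_step x y : 1 < y <= r -> 
  (x \in m_chain sigma y) = (x == y) || (x \in m_chain sigma (sigma y)).
Proof. by move=> /andP[y1 yr]; rewrite mem_m_chain ?(ltnW y1) //= y1. Qed.

Lemma anc_one x : 0 < r -> (x \in m_chain sigma 1) = (x == 1).
Proof. by move=> r0; rewrite mem_m_chain // orbF. Qed.

Lemma range_pos y : 0 < y <= r -> 0 < r.
Proof. by case/andP=> y0; apply: leq_trans. Qed.

Lemma anc_root y : 0 < y <= r -> 1 \in m_chain sigma y.
Proof.
move=> hy; have r0 := range_pos hy.
move: y hy; apply: anc_ind => [|y hy IH]; first by rewrite anc_one.
by rewrite anc_step // IH orbT.
Qed.

Lemma anc_le x y : 0 < y <= r -> x \in m_chain sigma y -> 0 < x <= y.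
Proof.
move=> hy; have r0 := range_pos hy; move: y hy.
apply: anc_ind => [|y hy IH]; first by rewrite anc_one // => /eqP->.
rewrite anc_step // => /orP[/eqP->|/IH/andP[-> xs]].
  by case/andP: hy => /ltnW ->; rewrite leqnn.
by case/andP: (parentP hy) => _ /ltnW; apply: leq_trans.
Qed.

Lemma anc_range x y : 0 < y <= r -> x \in m_chain sigma y -> 0 < x <= r.
Proof.
by move=> hy /(anc_le hy)/andP[-> /leq_trans->] //; case/andP: hy.
Qed.

Lemma anc_trans y x z : 0 < z <= r ->
  x \in m_chain sigma y -> y \in m_chain sigma z -> x \in m_chain sigma z.
Proof.
move=> hz xy; have r0 := range_pos hz; move: z hz.
apply: anc_ind => [|z hz IH]; first by rewrite [y \in _]anc_one // => /eqP y1; rewrite -y1.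
rewrite [y \in _]anc_step // => /orP[/eqP <- //|/IH xz].
by rewrite anc_step // xz orbT.
Qed.

(** Induction on [z] down from the root: if one of [x], [y] is [z], the other is its ancestor;
    otherwise both are ancestors of the parent of [z]. *)
Lemma anc_total x y z : 0 < z <= r ->
  x \in m_chain sigma z -> y \in m_chain sigma z ->
  x \in m_chain sigma y \/ y \in m_chain sigma x.
Proof.
move=> hz; have r0 := range_pos hz; move: z hz.
apply: anc_ind => [|z hz IH].
  by rewrite !anc_one // => /eqP-> /eqP->; left; rewrite anc_one.
move=> xz; rewrite anc_step // => /orP[/eqP-> //|]; first by left.
move=> yz; move: xz; rewrite anc_step // => /orP[/eqP->|xz]; last exact: IH.
by right; rewrite anc_step // yz orbT.
Qed.

Lemma anc_strict x y : 0 < y <= r -> x \in m_chain sigma y -> x != y ->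
  1 < y <= r /\ x \in m_chain sigma (sigma y).
Proof.
move=> hy; rewrite mem_m_chain // => /orP[->//|/andP[y1 xy]] _.
by split; rewrite // y1; case/andP: hy.
Qed.

(** The witness is the node just below [x] on the path to [y]; comparing such nodes decides which of
    two branches is on the left. *)
Lemma anc_child x y : 0 < y <= r -> x \in m_chain sigma y -> x != y ->
  exists a, [/\ 1 < a, sigma a = x & a \in m_chain sigma y].
Proof.
move=> hy; have r0 := range_pos hy; move: y hy.
apply: anc_ind => [|y hy IH]; first by rewrite anc_one // => ->.
rewrite anc_step // => /orP[->//|xy] _; have [->|xs] := eqVneq x (sigma y).
  exists y; split=> //; first by case/andP: hy.
  by apply: anc_refl; case/andP: hy => /ltnW ->.
have [a [a1 ax ay]] := IH xy xs; exists a; split=> //.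
by rewrite anc_step // ay orbT.
Qed.

(* The tree is drawn with siblings in increasing order from left to right. *)
Definition left_of (i j : nat) : bool :=
  has (fun a => has (fun b => [&& 1 < a, a < b & sigma a == sigma b])
    (m_chain sigma j)) (m_chain sigma i).

Lemma left_ofP i j : reflect
  (exists a b, [/\ a \in m_chain sigma i, b \in m_chain sigma j,
                   1 < a, a < b & sigma a = sigma b])
  (left_of i j).
Proof.
apply: (iffP hasP) => [[a ai /hasP[b bj /and3P[a1 ab /eqP sab]]]|].
  by exists a, b.
move=> [a [b [ai bj a1 ab sab]]]; exists a => //; apply/hasP; exists b => //.
by rewrite a1 ab sab eqxx.
Qed.

(** Once two branches diverge at siblings, all their descendants stay on the same sides, with the
    same witnesses. *)
Lemma left_ofWr i j k : 0 < k <= r ->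
  left_of i j -> j \in m_chain sigma k -> left_of i k.
Proof.
move=> hk /left_ofP[a [b [ai bj a1 ab sab]]] jk; apply/left_ofP.
by exists a, b; split=> //; apply: anc_trans jk.
Qed.

Lemma left_ofWl i j k : 0 < k <= r ->
  left_of i j -> i \in m_chain sigma k -> left_of k j.
Proof.
move=> hk /left_ofP[a [b [ai bj a1 ab sab]]] ik; apply/left_ofP.
by exists a, b; split=> //; apply: anc_trans ik.
Qed.

(** The siblings [a], [b] separate [i] from [j], and [c], [d] separate [j] from [k]; [b] and [c] are
    comparable, being ancestors of [j]. If they are equal, [a] and [d] are siblings. If [b] is
    strictly above [c], it is above the common parent of [c] and [d], so [a], [b] separate [i] from
    [k]; in the last case [c], [d] do. *)
Lemma left_of_trans j i k : 0 < i <= r -> 0 < j <= r -> 0 < k <= r ->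
  left_of i j -> left_of j k -> left_of i k.
Proof.
move=> hi hj hk /left_ofP[a [b [ai bj a1 ab sab]]] /left_ofP[c [d [cj dk c1 cd scd]]].
have hd := anc_range hk dk; have ha := anc_range hi ai.
have hb := anc_range hj bj; have hc := anc_range hj cj.
have d1 := ltn_trans c1 cd; have b1 := ltn_trans a1 ab.
have {}hd : 1 < d <= r by rewrite d1; case/andP: hd.
have {}ha : 1 < a <= r by rewrite a1; case/andP: ha.
apply/left_ofP; have [bc|bc] := eqVneq b c.
  by exists a, d; split; rewrite // ?sab ?bc // (ltn_trans ab) // bc.
have [/(anc_strict hc)/(_ bc)[_]|/(anc_strict hb)] := anc_total hj bj cj.
  rewrite scd => bd; exists a, b; split=> //.
  by apply: anc_trans hk (anc_trans _ bd (anc_parent hd)) dk; case/andP: hd => /ltnW->.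
rewrite eq_sym => /(_ bc)[_]; rewrite -sab => ca; exists c, d; split=> //.
by apply: anc_trans hi (anc_trans _ ca (anc_parent ha)) ai; case/andP: ha => /ltnW->.
Qed.

(** Two ancestors of [j] are comparable, but [a] strictly above [b] would be an ancestor of its own
    parent, and [b] above [a] would give [b <= a]. *)
Lemma siblings_disjoint a b j : 0 < j <= r -> 1 < a -> a < b ->
  sigma a = sigma b -> a \in m_chain sigma j -> b \in m_chain sigma j -> False.
Proof.
move=> hj a1 ab sab aj bj.
have ha := anc_range hj aj; have hb := anc_range hj bj.
have ha' : 1 < a <= r by rewrite a1; case/andP: ha.
have [/anc_strict|] := anc_total hj aj bj.
  case=> //; first by rewrite ltn_eqF.
  move=> _; rewrite -sab => /(anc_le (parent_range ha'))/andP[_].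
  by rewrite leqNgt; case/andP: (parentP ha') => _ ->.
by move=> /(anc_le ha)/andP[_]; rewrite leqNgt ab.
Qed.

Lemma left_of_nanc i j : 0 < i <= r -> 0 < j <= r -> left_of i j ->
  (i \notin m_chain sigma j) && (j \notin m_chain sigma i).
Proof.
move=> hi hj /left_ofP[a [b [ai bj a1 ab sab]]].
apply/andP; split; apply/negP => h.
  exact: (siblings_disjoint hj a1 ab sab (anc_trans hj ai h) bj).
exact: (siblings_disjoint hi a1 ab sab ai (anc_trans hi bj h)).
Qed.

Lemma left_of_asym i j : 0 < i <= r -> 0 < j <= r -> left_of i j -> ~~ left_of j i.
Proof.
move=> hi hj ij; apply/negP => /(left_of_trans hi hj hi ij)/(left_of_nanc hi hi).
by rewrite anc_refl.
Qed.

(** Induction on [j]. If its parent is incomparable with [i], the side is inherited from the parent.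
    Otherwise the parent lies strictly above [i], and [j] is compared with its sibling above [i]. *)
Lemma left_of_total i j : 0 < i <= r -> 0 < j <= r ->
  i \notin m_chain sigma j -> j \notin m_chain sigma i -> left_of i j \/ left_of j i.
Proof.
move=> hi; move: j; apply: anc_ind => [|j hj IH]; first by rewrite anc_root.
have hj' : 0 < j <= r by case/andP: hj => /ltnW->.
rewrite anc_step // negb_or => /andP[ij isj] ji.
have [si|/(IH isj)[/left_ofWr|/left_ofWl]] := boolP (sigma j \in m_chain sigma i);
  last 2 first.
- by move/(_ j hj' (anc_parent hj)); left.
- by move/(_ j hj' (anc_parent hj)); right.
have sji : sigma j != i.
  by apply: contraNneq isj => <-; apply: anc_refl; apply: parent_range.
have [a [a1 saj ai]] := anc_child hi si sji.
have jj := anc_refl hj'; case/andP: hj => j1 _.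
case: (ltngtP a j) => [aj|ja|aj]; last by rewrite -aj ai in ji.
  by left; apply/left_ofP; exists a, j.
by right; apply/left_ofP; exists j, a.
Qed.

(** * The generalized tower set *)

(* The nodes without this property form the rightmost branch. *)
Definition has_right (s : nat) : bool := has (left_of s) (iota 1 r).

Lemma has_rightP s : reflect (exists2 q, 0 < q <= r & left_of s q) (has_right s).
Proof.
by apply: (iffP hasP) => -[q hq sq]; exists q; rewrite // ?mem_iota1 // -mem_iota1.
Qed.

Let pairs := [seq (i, j) | i <- iota 1 (2 * r), j <- iota 1 r].

Definition tower_part : {fset nat * nat} :=
  [fset p in pairs | if p.1 <= r then left_of p.1 p.2
                     else (p.1 - r \in m_chain sigma p.2) && ~~ has_right (p.1 - r)].

Definition outer_part : {fset nat * nat} :=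
  [fset p in pairs |
     [&& r < p.1, p.1 - r \in m_chain sigma p.2 & has_right (p.1 - r)]].

Lemma mem_pairs i j : ((i, j) \in pairs) = (0 < i <= 2 * r) && (0 < j <= r).
Proof.
apply/allpairsP/andP => [[[x y] /= [hx hy [-> ->]]]|[hi hj]].
  by rewrite -!mem_iota1.
by exists (i, j); rewrite !mem_iota1.
Qed.

Lemma mem_pairs_shift s j : 0 < j <= r -> s \in m_chain sigma j -> (r + s, j) \in pairs.
Proof.
move=> hj /(anc_range hj)/andP[s0 sr].
by rewrite mem_pairs hj addn_gt0 s0 orbT mul2n -addnn leq_add2l sr.
Qed.

Lemma tower_partP i j : reflect
  (0 < j <= r /\ (0 < i <= r /\ left_of i j \/
    exists s, [/\ i = r + s, s \in m_chain sigma j & ~~ has_right s]))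
  ((i, j) \in tower_part).
Proof.
rewrite /tower_part !inE /=; apply: (iffP andP) => [[]|[hj]].
  rewrite mem_pairs => /andP[/andP[i0 i2r] ->]; case: (leqP i r) => [ir lij|ri /andP[h1 h2]].
    by split=> //; left; rewrite i0.
  by split=> //; right; exists (i - r); rewrite subnKC // ltnW.
case=> [[/andP[i0 ir] lij]|[s [-> sj ns]]].
  by rewrite mem_pairs i0 ir hj mul2n -addnn (leq_trans ir (leq_addr _ _)).
have /andP[s0 _] := anc_range hj sj.
by rewrite mem_pairs_shift // -{2}[r]addn0 leq_add2l leqNgt s0 addKn sj.
Qed.

Lemma outer_partP i j : reflect
  (0 < j <= r /\ exists s, [/\ i = r + s, s \in m_chain sigma j & has_right s])
  ((i, j) \in outer_part).
Proof.
rewrite /outer_part !inE /=; apply: (iffP andP) => [[]|[hj [s [-> sj ns]]]].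
  rewrite mem_pairs => /andP[_ ->] /and3P[ri h1 h2]; split=> //.
  by exists (i - r); rewrite subnKC // ltnW.
have /andP[s0 _] := anc_range hj sj.
by rewrite mem_pairs_shift // -{1}[r]addn0 ltn_add2l s0 addKn sj.
Qed.

Let S := tower_part `|` outer_part.

Lemma orientationP i j : reflect
  (0 < j <= r /\ (0 < i <= r /\ left_of i j \/ exists2 s, i = r + s & s \in m_chain sigma j))
  ((i, j) \in S).
Proof.
rewrite inE; apply: (iffP orP).
  case=> [/tower_partP[hj [lij|[s [-> sj _]]]]|/outer_partP[hj [s [-> sj _]]]];
    by split=> //; try (by left); right; exists s.
case=> hj [lij|[s -> sj]]; first by left; apply/tower_partP; split=> //; left.
have [hs|hs] := boolP (has_right s).
  by right; apply/outer_partP; split=> //; exists s.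
by left; apply/tower_partP; split=> //; right; exists s.
Qed.

(** * Slices of the tower part *)

(** The disjunction says that [i] comes no later than [j] in the depth-first order, where ancestors
    come first. *)
Lemma slice_tower_step i j : 0 < i <= r -> 0 < j <= r ->
  (i \in m_chain sigma j) || left_of i j ->
  slice tower_part i `<=` slice tower_part j.
Proof.
move=> hi hj /orP ij; apply/fsubsetP => x; rewrite !mem_slice.
case/tower_partP=> _ xi; apply/tower_partP; split=> //.
case: xi => [[hx lxi]|[s [-> si ns]]].
  left; split=> //; case: ij => [ij|ij]; first exact: left_ofWr lxi ij.
  exact: left_of_trans lxi ij.
right; exists s; split=> //; have hs := anc_range hi si.
case: ij => [ij|ij]; first exact: anc_trans ij.
(* A node [s] on the rightmost branch above [i] is also above [j]: below [s], [j] cannot be an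
   ancestor of [i]; [j] cannot be to the right of [s]; and to the left of [s] it would be to the
   left of [i]. *)
have [//|nsj] := boolP (s \in m_chain sigma j).
have [js|njs] := boolP (j \in m_chain sigma s).
  have := left_of_nanc hi hj ij.
  by rewrite (anc_trans hi js si) andbF.
have [sj|js] := left_of_total hs hj nsj njs.
  by case/negP: ns; apply/has_rightP; exists j.
by have := left_of_asym hi hj ij; rewrite (left_ofWr hi js si).
Qed.

(** Depth-first order is total on the nodes, and the other columns are empty. *)
Lemma slice_tower_chain i j :
  slice tower_part i `<=` slice tower_part j \/ slice tower_part j `<=` slice tower_part i.
Proof.
have slice0 k : ~~ (0 < k <= r) -> slice tower_part k = fset0.
  move=> nk; apply/fsetP=> x; rewrite mem_slice [RHS]inE.
  by apply/tower_partP => -[hk _]; rewrite hk in nk.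
have [hi|/slice0->] := boolP (0 < i <= r); last by left; apply: fsub0set.
have [hj|/slice0->] := boolP (0 < j <= r); last by right; apply: fsub0set.
have step := slice_tower_step.
have [ij|nij] := boolP (i \in m_chain sigma j); first by left; rewrite step ?ij.
have [ji|nji] := boolP (j \in m_chain sigma i); first by right; rewrite step ?ji.
by have [ij|ji] := left_of_total hi hj nij nji; [left|right]; rewrite step ?ij ?ji ?orbT.
Qed.

Lemma outer_part_attached i j : (i, j) \in outer_part ->
  i \notin pi1 tower_part `|` pi2 tower_part /\ j \in pi1 tower_part `&` pi2 tower_part.
Proof.
case/outer_partP=> hj [s [-> sj hs]]; have hs_range := anc_range hj sj.
have big : r + s <= r = false.
  by rewrite -{2}[r]addn0 leq_add2l leqNgt; case/andP: hs_range => ->.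
split; rewrite !inE.
  rewrite negb_or; apply/andP; split; apply/negP.
    case/pi1P=> q /tower_partP[hq [[/andP[_]]|[t [/addnI<- _]]]]; first by rewrite big.
    by rewrite hs.
  by case/pi2P=> q /tower_partP[/andP[_]]; rewrite big.
have [q hq sq] := has_rightP _ hs.
apply/andP; split.
  apply/pi1P; exists q; apply/tower_partP; split=> //; left; split=> //.
  exact: left_ofWl sq sj.
(* The root is an ancestor of every node and has nothing to its right, so [r + 1] is a row of every
   column. *)
apply/pi2P; exists (r + 1); apply/tower_partP; split=> //; right; exists 1.
split=> //; first exact: anc_root.
have r1 : 0 < 1 <= r by rewrite (range_pos hj).
by apply/has_rightP => -[p hp /(left_of_nanc r1 hp)]; rewrite anc_root.
Qed.

(** Strict inclusion of slices forbids [h] to precede [j] in depth-first order, and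
    [(j, h) \notin T] forbids [j] to be left of [h]; hence [j] is an ancestor of [h], and so is
    [s]. *)
Lemma outer_part_closed i j h :
  (i, j) \in outer_part -> h \in F_ tower_part j -> (i, h) \in outer_part.
Proof.
case/outer_partP=> hj [s [-> sj hs]] hF.
have /and3P[/pi2P[q qh] jh njh] : [&& h \in pi2 tower_part,
    slice tower_part j `<` slice tower_part h & (j, h) \notin tower_part].
  by move: hF; rewrite !inE.
have hh : 0 < h <= r by case/tower_partP: qh.
apply/outer_partP; split=> //; exists s; split=> //.
suff : j \in m_chain sigma h by apply: anc_trans.
apply: contraT => nanc; move: jh; rewrite fproperE => /andP[_ /negP[]].
have [hj'|nhj] := boolP (h \in m_chain sigma j); first by rewrite slice_tower_step ?hj'.
have [lt|lt] := left_of_total hj hh nanc nhj; last by rewrite slice_tower_step ?lt ?orbT.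
by case/negP: njh; apply/tower_partP; split=> //; left.
Qed.

Lemma orientation_offdiagonal : offdiagonal S.
Proof.
move=> [i j] /orientationP /= [hj hi]; case/andP: (hj) => j0 jr.
case: hi => [[hi lij]|[s -> sj]].
  case/andP: (hi) => i0 _; split=> //; apply: contraTneq lij => ->.
  by apply/negP => /(left_of_nanc hj hj); rewrite anc_refl.
have /andP[s0 _] := anc_range hj sj; split=> //; first by rewrite addn_gt0 s0 orbT.
by rewrite neq_ltn (leq_ltn_trans jr) ?orbT // -{1}[r]addn0 ltn_add2l.
Qed.

Lemma orientation_asym i j : (i, j) \in S -> (j, i) \notin S.
Proof.
case/orientationP=> hj hi; apply/negP => /orientationP[hi' hj'].
case: hi => [[hi lij]|[s iE sj]].
  case: hj' => [[_ lji]|[s jE si]].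
    by have := left_of_asym hi hj lij; rewrite lji.
  have /andP[s0 _] := anc_range hi' si; case/andP: hj => _.
  by rewrite jE -{2}[r]addn0 leq_add2l leqNgt s0.
have /andP[s0 _] := anc_range hj sj; case/andP: hi' => _.
by rewrite iE -{2}[r]addn0 leq_add2l leqNgt s0.
Qed.

(** * The set of pairs and its connectedness *)

(** For [i < j], [j] is never an ancestor of [i], so the condition defining [U'] means
    incomparability, that is, one node is left of the other. *)
Lemma memUP A : reflect
  ((exists i j, [/\ A = [fset i; j], 0 < i <= r, 0 < j <= r & left_of i j]) \/
   (exists s j, [/\ A = [fset r + s; j], 0 < j <= r & s \in m_chain sigma j]))
  (A \in U_ r sigma).
Proof.
have dbl x : 0 < x <= r -> 0 < x <= 2 * r.
  by case/andP=> -> xr; rewrite mul2n -addnn (leq_trans xr (leq_addr _ _)).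
rewrite /U_ in_fsetU; apply: (iffP orP) => [[]/imfset_pairsP|].
- case=> i [j [hi hj /and3P[ij jr nij] ->]]; left.
  have {}hi : 0 < i <= r by case/andP: hi => -> _; rewrite (leq_trans (ltnW ij)).
  have {}hj : 0 < j <= r by case/andP: hj => ->.
  have nji : j \notin m_chain sigma i.
    by apply/negP => /(anc_le hi)/andP[_]; rewrite leqNgt ij.
  have [lij|lji] := left_of_total hi hj nij nji; first by exists i, j.
  by exists j, i; split=> //; apply: fsetUC.
- case=> i [j [hi hj /and3P[ir rj ji] ->]]; right; exists (j - r), i.
  by split; rewrite // ?subnKC ?(ltnW rj) 1?fsetUC // ir; case/andP: hi => ->.
case=> [[i [j [-> hi hj lij]]]|[s [j [-> hj sj]]]].
  have /andP[nij nji] := left_of_nanc hi hj lij; left; apply/imfset_pairsP.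
  have := dbl _ hi; have := dbl _ hj; case/andP: hi => _ ir; case/andP: hj => _ jr hj hi.
  case: (ltngtP i j) => [lt|lt|ij]; first by exists i, j; rewrite lt jr nij hi hj.
    by exists j, i; rewrite lt ir nji hi hj; split=> //; apply: fsetUC.
  by move: nij; rewrite ij anc_refl // jr -ij; case/andP: hi => ->.
have /andP[s0 sr] := anc_range hj sj; right; apply/imfset_pairsP.
exists j, (r + s); split; [exact: dbl| | |exact: fsetUC].
  by rewrite addn_gt0 s0 orbT mul2n -addnn leq_add2l.
by rewrite -{2}[r]addn0 ltn_add2l s0 addKn sj; case/andP: hj => _ ->.
Qed.

Lemma U_orientation : U_ r sigma = [fset [fset p.1; p.2] | p in S].
Proof.
apply/fsetP=> A; apply/memUP/imfsetP => /=.
  case=> [[i [j [-> hi hj lij]]]|[s [j [-> hj sj]]]].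
    by exists (i, j) => //; apply/orientationP; split=> //; left.
  by exists (r + s, j) => //; apply/orientationP; split=> //; right; exists s.
case=> [[i j] /= /orientationP[hj [[hi lij]|[s -> sj]]] ->].
  by left; exists i, j.
by right; exists s, j.
Qed.

Lemma U_subset_C2 : U_ r sigma `<=` C2 (2 * r).
Proof.
apply/fsubsetP => A; rewrite /U_ in_fsetU => /orP[]/imfset_pairsP.
  case=> i [j [hi hj /and3P[ij _ _] ->]]; apply/imfset_pairsP.
  by exists i, j; rewrite ltn_eqF.
case=> i [j [hi hj /and3P[ir rj _] ->]]; apply/imfset_pairsP.
by exists i, j; rewrite ltn_eqF // (leq_ltn_trans ir).
Qed.

Lemma incomparable_U i j : 0 < i <= r -> 0 < j <= r ->
  [\/ i \in m_chain sigma j, j \in m_chain sigma i | [fset i; j] \in U_ r sigma].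
Proof.
move=> hi hj; have [ij|nij] := boolP (i \in m_chain sigma j); first by constructor.
have [ji|nji] := boolP (j \in m_chain sigma i); first by constructor.
have [lij|lji] := left_of_total hi hj nij nji; constructor 3; apply/memUP; left.
  by exists i, j.
by exists j, i; split=> //; apply: fsetUC.
Qed.

(** Two pairs are linked as soon as an element of one and an element of the other form a pair in
    [U_]. If no such choice exists, the ancestor relations it forces contradict the incomparability
    inside a pair. *)
Lemma connected_U : connected (U_ r sigma).
Proof.
have meet x (A C : {fset nat}) : x \in A -> x \in C -> A `&` C != fset0.
  by move=> xA xC; apply/fset0Pn; exists x; rewrite inE xA.
pose linked A B := exists C, [/\ C \in U_ r sigma, A `&` C != fset0 & B `&` C != fset0].
have linkedC A B : linked A B -> linked B A by case=> C []; exists C.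
have link x y A B : x \in A -> y \in B -> [fset x; y] \in U_ r sigma -> linked A B.
  move=> xA yB xyU; exists [fset x; y]; split=> //.
    by apply: meet xA _; rewrite !inE eqxx.
  by apply: meet yB _; rewrite !inE eqxx orbT.
have low s j : 0 < j <= r -> s \in m_chain sigma j -> [fset r + s; j] \in U_ r sigma.
  by move=> hj sj; apply/memUP; right; exists s, j.
have in1 (x y : nat) : x \in [fset x; y] by rewrite !inE eqxx.
have in2 (x y : nat) : y \in [fset x; y] by rewrite !inE eqxx orbT.
(* If [l] is above [i] or [i'], so is [t], and [r + t] is paired with that node. Otherwise an
   unlinked [l] would have both [i] and [i'] as ancestors, making them comparable. *)
have mixed i i' t l : 0 < i <= r -> 0 < i' <= r -> 0 < l <= r -> left_of i i' ->
    t \in m_chain sigma l -> linked [fset i; i'] [fset r + t; l].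
  move=> hi hi' hl lii' tl; have [nii' ni'i] := andP (left_of_nanc hi hi' lii').
  have down k : k \in [fset i; i'] -> 0 < k <= r -> l \in m_chain sigma k ->
      linked [fset i; i'] [fset r + t; l].
    move=> ki hk lk; apply: (link k (r + t)) => //.
    by rewrite fsetUC; apply: low => //; apply: anc_trans lk.
  have [il|li|] := incomparable_U hi hl; [|exact: down li|exact: link (in1 _ _) (in2 _ _)].
  have [i'l|li'|] := incomparable_U hi' hl; [|exact: down li'|exact: link (in2 _ _) (in2 _ _)].
  by case: (anc_total hl il i'l) => h; [rewrite h in nii'|rewrite h in ni'i].
move=> A B /memUP[[i [i' [-> hi hi' lii']]]|[s [i [-> hi si]]]]
  /memUP[[j [j' [-> hj hj' ljj']]]|[t [j [-> hj tj]]]]; rewrite -/(linked _ _).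
- have [nii' ni'i] := andP (left_of_nanc hi hi' lii').
  have [njj' nj'j] := andP (left_of_nanc hj hj' ljj').
  (* With no link, both [j] and [j'] would be ancestors of [i], hence comparable. *)
  have below l : 0 < l <= r -> l \in [fset j; j'] ->
      linked [fset i; i'] [fset j; j'] \/ l \in m_chain sigma i.
    move=> hl lj; have [il|li|] := incomparable_U hi hl; last first.
    + by left; apply: (link i l).
    + by right.
    have [i'l|li'|] := incomparable_U hi' hl; last by left; apply: (link i' l).
      by case: (anc_total hl il i'l) => h; [rewrite h in nii'|rewrite h in ni'i].
    by rewrite (anc_trans hi' il li') in nii'.
  have [//|ji] := below j hj (in1 _ _); have [//|j'i] := below j' hj' (in2 _ _).
  by case: (anc_total hi ji j'i) => h; [rewrite h in njj'|rewrite h in nj'j].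
- exact: mixed.
- exact/linkedC/mixed.
(* If one of [i], [j] is above the other, the shifted ancestor attached to the upper node can be
   paired with the lower node. *)
have [ij|ji|] := incomparable_U hi hj; last exact: link (in2 _ _) (in2 _ _).
  by apply: (link (r + s) j) => //; apply: low => //; apply: anc_trans ij.
apply: (link i (r + t)) => //.
by rewrite fsetUC; apply: low => //; apply: anc_trans ji.
Qed.

Lemma generalized_towerizable_U : generalized_towerizable (2 * r) (U_ r sigma).
Proof.
split; first exact: U_subset_C2.
have [omega [ord_omega omegaS]] : exists omega, ordinante (2 * r) omega /\
    [fset omega A | A in U_ r sigma] = S.
  rewrite U_orientation; apply: ordinante_orientation => i j ijS.
  by split; [case: (orientation_offdiagonal ijS)|apply: orientation_asym].
exists omega; split=> //; rewrite omegaS.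
apply: generalized_tower_relabel.
- exact: orientation_offdiagonal.
- by rewrite -U_orientation; apply: connected_U.
- exact: slice_tower_chain.
- exact: outer_part_attached.
- exact: outer_part_closed.
Qed.

End Tree.

Theorem theorem3p32 (k : fieldType) (n r : nat)
    (M : 'M[{mpoly k[n]}]_(r.+1, r)) (sigma : nat -> nat)
    (hM : standard_form M sigma) :
  generalized_towerizable (2 * r) (U_ r sigma).
Proof.
case: hM => _ [sigma_lt _ sigma2 sigma_mono] _.
apply: generalized_towerizable_U => j /andP[j1 jr].
rewrite sigma_lt ?(ltnW j1) // andbT.
(* Positivity of the parent: for [j > 2] it comes from [sigma j.-1 > 0] by monotonicity, and for
   [j = 2] from [sigma 2 = 1]. *)
case: (ltngtP j 2) => [||j2]; first by rewrite ltnNge j1.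
  by move=> j2; have /andP[s0 s1] := sigma_mono j (introT andP (conj j2 jr)); apply: leq_trans s1.
by rewrite j2 sigma2 // -j2.
Qed.
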